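(* Let $S_1, S_2, S_3$ be three spheres in $\mathbb{R}^3$ of radius $4/5$ centered at the vertices of an equilateral triangle of side length $\sqrt{3}$, and let $S_4$ be a sphere of radius $1/4$ whose center lies on the axis of symmetry of the triangle (the line through the triangle's centroid perpendicular to its plane) at distance $35/100$ from the plane of the triangle. Then the four spheres are pairwise disjoint, they have $12$ distinct common real tangent lines, and the four closed balls bounded by $S_1, S_2, S_3, S_4$ have six different geometric permutations.
   Context: A common tangent line to a collection of spheres is a line in $\mathbb{R}^3$ that is tangent to every sphere of the collection; lines are undirected. A line transversal to a set $\mathcal{S}$ of pairwise disjoint convex bodies in $\mathbb{R}^d$ is a line that meets every body in $\mathcal{S}$. Such a line meets the bodies in a certain order, and so induces two linear orders on $\mathcal{S}$ which are reverse to each other (one for each orientation of the line). These two orders are considered as a single object, called a geometric permutation of $\mathcal{S}$. *)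

(* Defs.v *)
From HB Require Import structures.
From mathcomp Require Import all_boot all_order all_algebra.
From mathcomp Require Import all_classical all_reals.

Set Implicit Arguments.
Unset Strict Implicit.
Unset Printing Implicit Defensive.

Import Order.TTheory GRing.Theory Num.Theory.

Local Open Scope classical_set_scope.
Local Open Scope ring_scope.

(* [R : realType] is the field of real numbers; R^3 is ['rV[R]_3]. *)

Definition dotp (R : realType) (n : nat) (x y : 'rV[R]_n) : R :=
  \sum_(i < n) x 0 i * y 0 i.

(* The norm that the library puts on ['rV[R]_n] is the max norm, so the
   Euclidean distance is defined from the dot product. *)
Definition edist (R : realType) (n : nat) (x y : 'rV[R]_n) : R :=
  Num.sqrt (dotp (x - y) (x - y)).

Definition esphere (R : realType) (n : nat) (c : 'rV[R]_n) (r : R) :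
    set 'rV[R]_n :=
  [set x | edist x c = r].

Definition eball (R : realType) (n : nat) (c : 'rV[R]_n) (r : R) :
    set 'rV[R]_n :=
  [set x | edist x c <= r].

Definition dist_to_set (R : realType) (n : nat) (x : 'rV[R]_n)
    (A : set 'rV[R]_n) : R :=
  inf [set edist x y | y in A].

Definition equilateral (R : realType) (n : nat) (s : R)
    (a b c : 'rV[R]_n) : Prop :=
  [/\ edist a b = s, edist b c = s & edist c a = s].

Definition triangle_plane (R : realType) (a b c : 'rV[R]_3) :
    set 'rV[R]_3 :=
  [set x | exists s t : R, x = a + s *: (b - a) + t *: (c - a)].

Definition centroid (R : realType) (a b c : 'rV[R]_3) : 'rV[R]_3 :=
  3^-1 *: (a + b + c).

Definition triangle_axis (R : realType) (a b c : 'rV[R]_3) :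
    set 'rV[R]_3 :=
  [set x | forall y z, triangle_plane a b c y -> triangle_plane a b c z ->
             dotp (x - centroid a b c) (y - z) = 0].

(* A line is its set of points, so it carries no direction. *)
Definition line_through (R : realType) (n : nat) (p u : 'rV[R]_n) :
    set 'rV[R]_n :=
  [set p + t *: u | t in [set: R]].

Definition is_line (R : realType) (n : nat) (L : set 'rV[R]_n) : Prop :=
  exists p u : 'rV[R]_n, u != 0 /\ L = line_through p u.

Definition tangent (R : realType) (n : nat) (L S : set 'rV[R]_n) : Prop :=
  exists! x : 'rV[R]_n, (L `&` S) x.

Definition common_tangents (R : realType) (n : nat) (I : Type)
    (S : I -> set 'rV[R]_n) : set (set 'rV[R]_n) :=
  [set L | is_line L /\ forall i, tangent L (S i)].

Definition line_transversals (R : realType) (n : nat) (I : Type)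
    (B : I -> set 'rV[R]_n) : set (set 'rV[R]_n) :=
  [set L | is_line L /\ forall i, L `&` B i !=set0].

(* [meets_before B p u i j]: travelling from p in direction u, one goes through
   all points of B i on the line before any point of B j.  When the line meets
   all members of a pairwise disjoint family B of convex bodies, this is a
   strict linear order on the indices. *)
Definition meets_before (R : realType) (n : nat) (I : Type)
    (B : I -> set 'rV[R]_n) (p u : 'rV[R]_n) : I -> I -> Prop :=
  fun i j => forall s t : R, B i (p + s *: u) -> B j (p + t *: u) -> s < t.

(* The orders induced on B by the two orientations of L, as a single object. *)
Definition induced_orders (R : realType) (n : nat) (I : Type)
    (B : I -> set 'rV[R]_n) (L : set 'rV[R]_n) : set (I -> I -> Prop) :=
  [set o | exists p u : 'rV[R]_n,
     [/\ u != 0, L = line_through p u & o = meets_before B p u]].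

Definition geometric_permutations (R : realType) (n : nat) (I : Type)
    (B : I -> set 'rV[R]_n) : set (set (I -> I -> Prop)) :=
  [set induced_orders B L | L in line_transversals B].

(* Main.v *)
Require Import Defs.
From HB Require Import structures.
From mathcomp Require Import all_boot all_order all_algebra.
From mathcomp Require Import all_classical all_reals.
From mathcomp Require Import ring lra.

Set Implicit Arguments.
Unset Strict Implicit.
Unset Printing Implicit Defensive.

Import Order.TTheory GRing.Theory Num.Theory.

Local Open Scope classical_set_scope.
Local Open Scope card_scope.
Local Open Scope ring_scope.

(** Put the origin at the centroid o of the triangle.  Its vertices become
    o + A, o + B, o + C with A, B, C unit vectors of sum 0 and pairwise products
    -1/2, and the fourth center becomes o + h N with N a unit normal and
    h = 7/20.  Write a line as o + q + t u with |u| = 1 and q orthogonal to u,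
    and read u and q through their products with A, B, C, N, say
    (al, be, ga, de) for u; let m = 1 - de^2.

    Tangency to the four spheres is then a polynomial system.  Adding and
    subtracting its equations determines q from u, and leaves two conditions
    ([tangency_system]): a quadratic equation in m, which has two roots, both
    in [22/25, 24/25] ([quadratic_roots]), and
    al * be * ga = foot_height m * de.  Together with al + be + ga = 0 and
    al^2 + be^2 + ga^2 = 3m/2, the second one says that al, be, ga are, in
    some order, the three roots of X^3 - (3/4) m X - foot_height m * de.  This
    cubic has three distinct real roots ([three_real_roots]).  Orienting lines
    by de > 0, each of the two values of m gives 6 directions, one for each
    arrangement of the roots, hence 12 tangents ([card_common_tangents]).

    A line crosses disjoint balls in the order of the projections of their
    centers onto it ([meets_before_balls]), so a geometric permutation is the
    ordering, up to reversal, of al, be, ga and h de.  Adding the inequalities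
    for the three large balls gives m >= 18/25: the line is too close to the
    plane of the triangle for h de to be extreme among the four numbers
    ([last_not_extreme]).  That leaves 4!/2 - 3! = 6 geometric permutations.
    All occur: on the tangents with a given m, the roots satisfy
    x < y < 0 < h de < z, and the assignment of x, y, z to the vertices is
    arbitrary. *)

(** * Dot product, spheres and balls *)

Section DotProduct.
Variables (R : realType) (n : nat).
Implicit Types (x y z c e p q u : 'rV[R]_n) (a r s t : R).

Lemma dotpC x y : dotp x y = dotp y x.
Proof. by apply: eq_bigr => i _; rewrite mulrC. Qed.

Lemma dotpDl x y z : dotp (x + y) z = dotp x z + dotp y z.
Proof. by rewrite -big_split; apply: eq_bigr => i _; rewrite mxE mulrDl. Qed.

Lemma dotpZl a x y : dotp (a *: x) y = a * dotp x y.
Proof. by rewrite mulr_sumr; apply: eq_bigr => i _; rewrite mxE mulrA. Qed.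

Lemma dotpDr x y z : dotp x (y + z) = dotp x y + dotp x z.
Proof. by rewrite !(dotpC x) dotpDl. Qed.

Lemma dotpZr a x y : dotp x (a *: y) = a * dotp x y.
Proof. by rewrite !(dotpC x) dotpZl. Qed.

Lemma dotpNl x y : dotp (- x) y = - dotp x y.
Proof. by rewrite -scaleN1r dotpZl mulN1r. Qed.

Lemma dotpNr x y : dotp x (- y) = - dotp x y.
Proof. by rewrite dotpC dotpNl dotpC. Qed.

Lemma dotp0r x : dotp x 0 = 0.
Proof. by rewrite -(scale0r 0) dotpZr mul0r. Qed.

Definition dotpE := (dotpDl, dotpDr, dotpNl, dotpNr, dotpZl, dotpZr).

Lemma dotp_ge0 x : 0 <= dotp x x.
Proof. by apply: sumr_ge0 => i _; rewrite -expr2 sqr_ge0. Qed.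

Lemma dotp_eq0 x : (dotp x x == 0) = (x == 0).
Proof.
apply/idP/eqP => [|->]; last by rewrite dotp0r.
rewrite psumr_eq0 => [/allP x0|i _]; last by rewrite -expr2 sqr_ge0.
apply/rowP => i; rewrite mxE; apply/eqP.
by have := x0 i (mem_index_enum _); rewrite mulf_eq0 orbb.
Qed.

Lemma dotp_gt0 x : x != 0 -> 0 < dotp x x.
Proof. by move=> x0; rewrite lt_neqAle dotp_ge0 eq_sym dotp_eq0 x0. Qed.

Lemma edist_sqr x y : edist x y ^+ 2 = dotp (x - y) (x - y).
Proof. by rewrite sqr_sqrtr // dotp_ge0. Qed.

Lemma esphereE c r x : 0 <= r -> esphere c r x <-> dotp (x - c) (x - c) = r ^+ 2.
Proof.
move=> r0; split => [<-|E]; first by rewrite sqr_sqrtr // dotp_ge0.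
by rewrite /esphere /= /edist E sqrtr_sqr ger0_norm.
Qed.

Lemma eballE c r x : 0 <= r -> eball c r x <-> dotp (x - c) (x - c) <= r ^+ 2.
Proof.
move=> r0; rewrite -(@ler_sqrt _ _ (r ^+ 2)) ?sqr_ge0 //.
by rewrite sqrtr_sqr ger0_norm.
Qed.

(** Expanding 0 <= |s X + r Y|^2 for X = x - c, Y = x - e bounds the product of
    X and Y below by - r s, which is the triangle inequality in squared form. *)
Lemma eball_disjoint c e r s x : 0 < r -> 0 < s ->
  (r + s) ^+ 2 < dotp (c - e) (c - e) ->
  eball c r x -> eball e s x -> False.
Proof.
move=> r0 s0 far /eballE -/(_ (ltW r0)) xc /eballE -/(_ (ltW s0)) xe.
pose X := x - c; pose Y := x - e.
have ceE : c - e = Y - X by rewrite /X /Y opprB [RHS]addrC addrA subrK.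
have := dotp_ge0 (s *: X + r *: Y).
move: far xc xe; rewrite ceE -/X -/Y.
move: X Y {ceE} => X Y; rewrite !dotpE (dotpC Y X) => far xc xe.
set XY := dotp X Y in far *; set XX := dotp X X in far xc *.
set YY := dotp Y Y in far xe * => ge0.
have xc' : s ^+ 2 * XX <= s ^+ 2 * r ^+ 2 by rewrite ler_wpM2l // sqr_ge0.
have xe' : r ^+ 2 * YY <= r ^+ 2 * s ^+ 2 by rewrite ler_wpM2l // sqr_ge0.
have : 0 <= (r * s) * (2 * (XY + r * s)) by lra.
rewrite pmulr_rge0 ?mulr_gt0 // => ge0'; lra.
Qed.

End DotProduct.

(** * Lines *)

Section Lines.
Variables (R : realType) (n : nat).
Implicit Types (x y z c e o p q u v : 'rV[R]_n) (a b r s t : R).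

Lemma line_through_shift p u a b : b != 0 ->
  line_through (p + a *: u) (b *: u) = line_through p u.
Proof.
move=> b0; apply/seteqP; split => x [t _ <-].
  by exists (a + t * b) => //; rewrite scalerDl addrA scalerA.
exists ((t - a) / b) => //.
by rewrite scalerA divfK // scalerBl -addrA subrKC.
Qed.

Lemma line_through_opp p u : line_through p (- u) = line_through p u.
Proof.
rewrite -(line_through_shift p u 0 (b := -1)) ?oppr_eq0 ?oner_eq0 //.
by rewrite scale0r addr0 scaleN1r.
Qed.

Lemma line_through_normal o (L : set 'rV[R]_n) : is_line L ->
  exists q u, [/\ dotp u u = 1, dotp q u = 0 & L = line_through (o + q) u].
Proof.
move=> [p [v [v0 ->]]].
have l0 : 0 < Num.sqrt (dotp v v).
  by rewrite sqrtr_gt0 dotp_gt0.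
set l := Num.sqrt _ in l0; pose u := l^-1 *: v.
have uu : dotp u u = 1.
  rewrite /u !dotpE mulrA -(@sqr_sqrtr _ (dotp v v)) ?dotp_ge0 // -/l.
  by field; rewrite gt_eqF.
exists (p - o - dotp (p - o) u *: u), u; split => //.
  by rewrite (dotpDl (p - o)) dotpNl dotpZl uu mulr1 subrr.
rewrite addrA (addrC p) addrA subrr add0r -scaleNr /u scalerA.
by rewrite line_through_shift // invr_eq0 gt_eqF.
Qed.

Lemma line_through_dir p u q v : v != 0 ->
  line_through p u = line_through q v ->
  exists a b, [/\ q = p + a *: u, v = b *: u & b != 0].
Proof.
move=> v0 E.
have [a _ qE] : line_through p u q by rewrite E; exists 0; rewrite ?scale0r ?addr0.
have [b _ bE] : line_through p u (q + v) by rewrite E; exists 1; rewrite ?scale1r.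
have vE : v = (b - a) *: u.
  by apply: (addrI q); rewrite -bE -qE scalerBl -addrA subrKC.
exists a, (b - a); split => //.
by apply: contraNneq v0 => b0; rewrite vE b0 scale0r.
Qed.

(** The foot o + q of the perpendicular from o is determined by the line, and
    its unit direction up to sign. *)
Lemma line_through_normal_inj o q u q' u' :
  dotp u u = 1 -> dotp u' u' = 1 -> dotp q u = 0 -> dotp q' u' = 0 ->
  line_through (o + q) u = line_through (o + q') u' ->
  q = q' /\ (u' = u \/ u' = - u).
Proof.
move=> uu uu' qu qu'.
have u'0 : u' != 0 by rewrite -dotp_eq0 uu' oner_eq0.
move=> /(line_through_dir u'0)[a [b [qE uE b0]]].
have b2 : b ^+ 2 = 1 by move: uu'; rewrite uE !dotpE uu mulr1.
have {}qE : q' = q + a *: u by apply: (addrI o); rewrite addrA.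
have a0 : a = 0.
  move: qu'; rewrite qE uE !dotpE qu uu mulr0 add0r mulr1 => /eqP.
  by rewrite mulf_eq0 (negPf b0) orbF => /eqP.
split; first by rewrite qE a0 scale0r addr0.
move/eqP: b2; rewrite sqrf_eq1 => /orP[] /eqP bE; rewrite uE bE.
  by left; rewrite scale1r.
by right; rewrite scaleN1r.
Qed.

(** For a unit vector u, the squared distance from c to the line
    [line_through p u]. *)
Definition line_dist2 p u c : R := dotp (p - c) (p - c) - dotp (p - c) u ^+ 2.

Lemma dist2_on_line p u c t : dotp u u = 1 ->
  dotp (p + t *: u - c) (p + t *: u - c) =
  line_dist2 p u c + (t + dotp (p - c) u) ^+ 2.
Proof.
move=> uu; rewrite addrAC /line_dist2 (dotpDl (p - c)) 2!(dotpDr _ (p - c)).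
rewrite !dotpZl !dotpZr uu (dotpC u); ring.
Qed.

Lemma tangent_lineP p u c r : dotp u u = 1 -> 0 <= r ->
  tangent (line_through p u) (esphere c r) <-> line_dist2 p u c = r ^+ 2.
Proof.
move=> uu r0; have u0 : u != 0 by rewrite -dotp_eq0 uu oner_eq0.
pose f := dotp (p - c) u.
have onS t : esphere c r (p + t *: u) <-> line_dist2 p u c + (t + f) ^+ 2 = r ^+ 2.
  by rewrite esphereE // dist2_on_line.
split.
  move=> [x [[[t _ <-] /onS St] uniq]].
  (* The reflection of t in the foot - f of c is another solution, so t = - f. *)
  have St' : esphere c r (p + (- (f + f) - t) *: u).
    by apply/onS; rewrite -St; ring.
  have /addrI/eqP := uniq _ (conj (ex_intro2 _ _ _ I erefl) St').
  rewrite -subr_eq0 -scalerBl scaler_eq0 (negPf u0) orbF => /eqP tE.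
  have tf : t + f = 0 by lra.
  by rewrite -St tf expr0n addr0.
move=> D; exists (p + (- f) *: u); split.
  by split; [exists (- f) | apply/onS; rewrite D addNr expr0n addr0].
move=> x [[t _ <-] /onS /eqP]; rewrite D -subr_eq0 addrAC subrr add0r.
by rewrite sqrf_eq0 addr_eq0 => /eqP ->.
Qed.

Lemma meets_ballP p u c r : dotp u u = 1 -> 0 <= r ->
  (line_through p u `&` eball c r !=set0) <-> line_dist2 p u c <= r ^+ 2.
Proof.
move=> uu r0; split.
  move=> [x [[t _ <-]]]; rewrite eballE // dist2_on_line //.
  by apply: le_trans; rewrite lerDl sqr_ge0.
move=> D; exists (p + (- dotp (p - c) u) *: u); split; first by eexists.
by apply/eballE; rewrite // dist2_on_line // addNr expr0n addr0.
Qed.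

Lemma line_dist2_foot o q u e : dotp q u = 0 ->
  line_dist2 (o + q) u (o + e) =
  dotp q q - 2 * dotp q e + dotp e e - dotp u e ^+ 2.
Proof.
move=> qu; have -> : line_dist2 (o + q) u (o + e) = line_dist2 q u e.
  by rewrite /line_dist2 opprD addrACA subrr add0r.
by rewrite /line_dist2 !dotpE qu (dotpC e q) (dotpC e u); ring.
Qed.

End Lines.

(** * Arrangements of three elements *)

Definition arrangements (T : Type) (x y z : T) : seq (T * T * T) :=
  [:: (x, y, z); (x, z, y); (y, x, z); (y, z, x); (z, x, y); (z, y, x)].

Lemma arrangements_uniq (T : eqType) (x y z : T) :
  x != y -> x != z -> y != z -> uniq (arrangements x y z).
Proof.
move=> /negPf xy /negPf xz /negPf yz; rewrite /= !inE !xpair_eqE !eqxx.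
by rewrite !(eq_sym y x) !(eq_sym z x) !(eq_sym z y) xy xz yz.
Qed.

Lemma arrangements_map (T U : eqType) (f : T -> U) (x y z r1 r2 r3 : T) :
  (r1, r2, r3) \in arrangements x y z ->
  (f r1, f r2, f r3) \in arrangements (f x) (f y) (f z).
Proof.
by rewrite !inE !xpair_eqE => /or4P[|||/or3P[]] /andP[/andP[]] /eqP-> /eqP-> /eqP->;
  rewrite !eqxx ?orbT.
Qed.

(** Two monic cubics with the same coefficients have the same roots, with
    multiplicity. *)
Lemma arrangements_symmetric (F : fieldType) (x y z r s t : F) :
  reflect [/\ r + s + t = x + y + z,
              r * s + s * t + t * r = x * y + y * z + z * x &
              r * s * t = x * y * z]
          ((r, s, t) \in arrangements x y z).
Proof.
apply: (iffP idP) => [|[e1 e2 e3]].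
  by rewrite !inE !xpair_eqE => /or4P[|||/or3P[]] /andP[/andP[]]
    /eqP-> /eqP-> /eqP->; split; ring.
have pair_eq (u v w p q : F) : u + v + w = u + p + q ->
    u * v + v * w + w * u = u * p + p * q + q * u ->
    (v == p) && (w == q) || (v == q) && (w == p).
  move=> f1 f2.
  have {}f1 : v + w = p + q by apply: (addrI u); rewrite !addrA.
  have wE : w = p + q - v by rewrite -f1 [RHS]addrC addKr.
  have /eqP : (v - p) * (v - q) = 0.
    transitivity (u * p + p * q + q * u - (u * v + v * w + w * u)).
      by rewrite wE; ring.
    by rewrite f2 subrr.
  rewrite mulf_eq0 !subr_eq0 wE => /orP[] /eqP ->.
    by rewrite eqxx [p + q]addrC addrK eqxx.
  by rewrite eqxx addrK eqxx orbT.
have : (r - x) * (r - y) * (r - z) = 0.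
  have -> : (r - x) * (r - y) * (r - z) = r ^+ 3 - (x + y + z) * r ^+ 2
      + (x * y + y * z + z * x) * r - x * y * z by ring.
  by rewrite -e1 -e2 -e3; ring.
move=> /eqP; rewrite !mulf_eq0 !subr_eq0 -orbA !inE !xpair_eqE => /or3P[] /eqP rE.
- rewrite rE in e1 e2 *; rewrite eqxx /=.
  by case/orP: (pair_eq _ _ _ _ _ e1 e2) => ->; rewrite ?orbT.
- rewrite rE in e1 e2 *; rewrite eqxx /=.
  have f1 : y + s + t = y + x + z by rewrite e1; ring.
  have f2 : y * s + s * t + t * y = y * x + x * z + z * y by rewrite e2; ring.
  by case/orP: (pair_eq _ _ _ _ _ f1 f2) => ->; rewrite ?orbT.
- rewrite rE in e1 e2 *; rewrite eqxx /=.
  have f1 : z + s + t = z + x + y by rewrite e1; ring.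
  have f2 : z * s + s * t + t * z = z * x + x * y + y * z by rewrite e2; ring.
  by case/orP: (pair_eq _ _ _ _ _ f1 f2) => ->; rewrite ?orbT.
Qed.

(** Each of x, y, z lies in [e, -2e], so that (t - e)(-2e - t) >= 0 for each of
    them; these three inequalities are added. *)
Lemma sum_sqr_bounded_below (R : realDomainType) (e x y z : R) :
  x + y + z = 0 -> e <= x -> e <= y -> e <= z ->
  x ^+ 2 + y ^+ 2 + z ^+ 2 <= 6 * e ^+ 2.
Proof.
move=> xyz ex ey ez.
have bound t : e <= t -> t <= - 2 * e -> t ^+ 2 + e * t <= 2 * e ^+ 2.
  move=> et te; have : 0 <= (t - e) * (- 2 * e - t) by rewrite mulr_ge0 //; lra.
  lra.
have bnd_x := bound x ex ltac:(lra); have bnd_y := bound y ey ltac:(lra).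
have bnd_z := bound z ez ltac:(lra).
have : e * (x + y + z) = 0 by rewrite xyz mulr0.
lra.
Qed.

(** * The tangency equations *)

Section TangentDirections.
Variable R : realType.
Implicit Types (al be ga de m q x y z w s t : R).

(** The product with N of the foot of a common tangent, as forced by the
    tangency to the fourth sphere (see [tangency_system]). *)
Definition foot_height m : R := (249 * m - 169) / 280.

(** These equations characterize the unit vectors, with products al, be, ga, de
    with A, B, C, N, that are directions of common tangents. *)
Definition tangent_direction al be ga de : Prop :=
  let m : R := 1 - de ^+ 2 in
  [/\ al + be + ga = 0,
      2 / 3 * (al ^+ 2 + be ^+ 2 + ga ^+ 2) = m,
      m ^+ 2 / 16 + foot_height m ^+ 2 = m / 2 - 9 / 25 &
      al * be * ga = foot_height m * de].

(** Here x, y, z, w are the products of the foot q with A, B, C, N and P is |q|^2.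
    The sum of the three equations at the vertices gives P = m/2 - 9/25, each of
    them then gives x, y or z, and the fourth sphere gives w.  Substituting back,
    orthogonality of q and u becomes al * be * ga = w * de, because
    al^3 + be^3 + ga^3 = 3 al be ga, and the formula for P becomes
    m^2/16 + w^2 = m/2 - 9/25, because al^4 + be^4 + ga^4 = 9/8 m^2. *)
Lemma tangency_system al be ga de x y z w :
  let P := 2 / 3 * (x ^+ 2 + y ^+ 2 + z ^+ 2) + w ^+ 2 in
  let m : R := 1 - de ^+ 2 in
  al + be + ga = 0 -> 2 / 3 * (al ^+ 2 + be ^+ 2 + ga ^+ 2) + de ^+ 2 = 1 ->
  [/\ x + y + z = 0, 2 / 3 * (x * al + y * be + z * ga) + w * de = 0 &
   [/\ P - 2 * x + 1 - al ^+ 2 = (4 / 5) ^+ 2,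
       P - 2 * y + 1 - be ^+ 2 = (4 / 5) ^+ 2,
       P - 2 * z + 1 - ga ^+ 2 = (4 / 5) ^+ 2 &
       P - 2 * (7 / 20 * w) + (7 / 20) ^+ 2 - (7 / 20 * de) ^+ 2 = (1 / 4) ^+ 2]]
  <-> tangent_direction al be ga de /\
      [/\ x = m / 4 - al ^+ 2 / 2, y = m / 4 - be ^+ 2 / 2,
          z = m / 4 - ga ^+ 2 / 2 & w = foot_height m].
Proof.
move=> P m e1 u1.
have gaE : ga = - al - be by lra.
have mE : m = 2 / 3 * (al ^+ 2 + be ^+ 2 + ga ^+ 2) by rewrite /m; lra.
have deE : de ^+ 2 = 1 - m by rewrite /m; ring.
have cubesum : al ^+ 3 + be ^+ 3 + ga ^+ 3 = 3 * (al * be * ga) by rewrite gaE; ring.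
have quartsum : al ^+ 4 + be ^+ 4 + ga ^+ 4 = 9 / 8 * m ^+ 2.
  by rewrite mE gaE; field.
have sqdot : m / 4 * (al + be + ga) - (al ^+ 3 + be ^+ 3 + ga ^+ 3) / 2 =
    - (3 / 2) * (al * be * ga) by rewrite e1 cubesum; field.
have footP : x = m / 4 - al ^+ 2 / 2 -> y = m / 4 - be ^+ 2 / 2 ->
    z = m / 4 - ga ^+ 2 / 2 -> w = foot_height m ->
    (2 / 3 * (x * al + y * be + z * ga) + w * de =
       foot_height m * de - al * be * ga) /\
    P = m ^+ 2 / 16 + foot_height m ^+ 2.
  move=> xE yE zE wE; split.
    rewrite xE yE zE wE.
    transitivity (2 / 3 * (m / 4 * (al + be + ga) - (al ^+ 3 + be ^+ 3 + ga ^+ 3) / 2)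
      + foot_height m * de); first by field.
    by rewrite sqdot; field.
  rewrite /P xE yE zE wE.
  transitivity (2 / 3 * (3 * m ^+ 2 / 16 - m / 4 * (al ^+ 2 + be ^+ 2 + ga ^+ 2)
    + (al ^+ 4 + be ^+ 4 + ga ^+ 4) / 4) + foot_height m ^+ 2); first by field.
  have -> : al ^+ 2 + be ^+ 2 + ga ^+ 2 = 3 / 2 * m by rewrite mE; field.
  by rewrite quartsum; field.
have -> : (7 / 20 * de) ^+ 2 = (7 / 20) ^+ 2 * (1 - m) by rewrite exprMn deE.
rewrite /tangent_direction -/m.
split.
  move=> [f1 f2 [tA tB tC tN]].
  have PE : P = m / 2 - 9 / 25 by lra.
  have xE : x = m / 4 - al ^+ 2 / 2 by lra.
  have yE : y = m / 4 - be ^+ 2 / 2 by lra.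
  have zE : z = m / 4 - ga ^+ 2 / 2 by lra.
  have wE : w = foot_height m by rewrite /foot_height; lra.
  have [f2' P'] := footP xE yE zE wE.
  by split; split => //; [rewrite -P' PE | apply/esym/subr0_eq; rewrite -f2'].
move=> [[_ _ quad e3] [xE yE zE wE]].
have [f2' P'] := footP xE yE zE wE.
have PE : P = m / 2 - 9 / 25 by rewrite P' quad.
split; [lra | by rewrite f2' e3 subrr |].
by move: wE; rewrite PE /foot_height => wE; split; lra.
Qed.

(** In the unknown 1 - m the roots are 18 / (290 - 21 sqrt 39) and
    18 / (290 + 21 sqrt 39). *)
Lemma quadratic_roots : exists m1 m2 : R,
  [/\ 22 / 25 <= m1 <= 24 / 25, 22 / 25 <= m2 <= 24 / 25, m1 != m2 &
   forall m, m ^+ 2 / 16 + foot_height m ^+ 2 = m / 2 - 9 / 25 <->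
     m = m1 \/ m = m2].
Proof.
pose r : R := Num.sqrt 39.
have r2 : r ^+ 2 = 39 by rewrite sqr_sqrtr // ler0n.
have r0 : 0 <= r := sqrtr_ge0 _.
have rl : 6 <= r by nra.
have ru : r <= 25 / 4 by nra.
pose k1 := 290 - 21 * r; pose k2 := 290 + 21 * r.
have [k1l k1u] : 150 <= k1 /\ k1 <= 164 by split; rewrite /k1; lra.
have [k2l k2u] : 416 <= k2 /\ k2 <= 422 by split; rewrite /k2; lra.
have k1_gt0 : 0 < k1 by lra.
have k2_gt0 : 0 < k2 by lra.
exists (1 - 18 / k1), (1 - 18 / k2); split.
- have [dl du] : 18 / 164 <= 18 / k1 /\ 18 / k1 <= 18 / 150.
    by split; rewrite ler_pM2l ?lef_pV2 ?posrE //; lra.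
  by apply/andP; split; lra.
- have [dl du] : 18 / 422 <= 18 / k2 /\ 18 / k2 <= 18 / 416.
    by split; rewrite ler_pM2l ?lef_pV2 ?posrE //; lra.
  by apply/andP; split; lra.
- apply/eqP => /addrI/oppr_inj/(mulfI _) -/(_ ltac:(by rewrite pnatr_eq0)) /invr_inj.
  lra.
move=> m.
have factor : 280 ^+ 2 * (m ^+ 2 / 16 + foot_height m ^+ 2 - (m / 2 - 9 / 25)) =
    k1 * k2 * ((m - (1 - 18 / k1)) * (m - (1 - 18 / k2))).
  transitivity ((k1 * (m - 1) + 18) * (k2 * (m - 1) + 18)).
    transitivity ((290 ^+ 2 - 21 ^+ 2 * r ^+ 2) * (m - 1) ^+ 2
       + 18 * 580 * (m - 1) + 18 ^+ 2); last by rewrite /k1 /k2; ring.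
    by rewrite r2 /foot_height; field.
  by field; rewrite !gt_eqF.
split => [quad|mE].
  move: factor; rewrite quad subrr mulr0 => /esym/eqP.
  rewrite !mulf_eq0 (gt_eqF k1_gt0) (gt_eqF k2_gt0) !subr_eq0 /=.
  by move=> /orP[] /eqP; [left|right].
have nz : (280 : R) ^+ 2 != 0 by rewrite expf_neq0 // pnatr_eq0.
apply/subr0_eq/(mulfI nz); rewrite factor.
by case: mE => ->; rewrite subrr ?mulr0 ?mul0r ?mulr0.
Qed.

(** With s = sqrt m, the cubic X^3 - (3/4) m X - q is negative at -s, positive at
    -s/2 and negative at 0, since 4 q < s^3.  This gives x and y; the third root
    is z = - x - y. *)
Lemma three_real_roots m q : 0 < m -> 0 < q -> 16 * q ^+ 2 < m ^+ 3 ->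
  exists x y z, [/\ x < y, y < 0 & Num.sqrt m / 2 < z] /\
    [/\ x + y + z = 0, 2 / 3 * (x ^+ 2 + y ^+ 2 + z ^+ 2) = m & x * y * z = q].
Proof.
move=> m0 q0 qm; pose s := Num.sqrt m.
have s0 : 0 < s by rewrite sqrtr_gt0.
have mE : m = s ^+ 2 by rewrite sqr_sqrtr // ltW.
have s3 : 4 * q < s ^+ 3.
  rewrite -(@ltr_pXn2r _ 2) ?nnegrE ?exprn_ge0 ?mulr_ge0 ?ltW //.
  by rewrite -exprM mulnC exprM -mE exprMn; lra.
pose p : {poly R} := 'X^3 - (3 / 4 * m) *: 'X - q%:P.
have pE t : p.[t] = t ^+ 3 - 3 / 4 * m * t - q by rewrite /p !hornerE.
have [x /andP[xl xu] /rootP px] : exists2 x, - s <= x <= - (s / 2) & root p x.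
  apply: poly_ivt; first by lra.
  by rewrite !pE mE; apply/andP; split; lra.
have [y /andP[yl yu] /rootP py] : exists2 y, - (s / 2) <= y <= 0 & root p y.
  suff [y yI py] : exists2 y, - (s / 2) <= y <= 0 & root (- p) y.
    by exists y; rewrite // -rootN.
  apply: poly_ivt; first by lra.
  by rewrite !hornerN !pE mE; apply/andP; split; nra.
rewrite pE mE in px; rewrite pE mE in py.
have xu' : x != - (s / 2).
  by apply/eqP => xE; move: px; rewrite xE => px; lra.
have yl' : y != - (s / 2).
  by apply/eqP => yE; move: py; rewrite yE => py; lra.
have {xu'}xu : x < - (s / 2) by rewrite lt_neqAle xu'.
have {yl'}yl : - (s / 2) < y by rewrite lt_neqAle eq_sym yl'.
have {yu}y0 : y < 0.
  rewrite lt_neqAle yu andbT; apply/eqP => yE.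
  by move: py; rewrite yE => py; lra.
have xy : x ^+ 2 + x * y + y ^+ 2 = 3 / 4 * s ^+ 2.
  have nz : x - y != 0 by rewrite lt_eqF //; lra.
  apply/subr0_eq/(mulfI nz); rewrite mulr0.
  transitivity ((x ^+ 3 - 3 / 4 * s ^+ 2 * x - q) - (y ^+ 3 - 3 / 4 * s ^+ 2 * y - q)).
    by field.
  by rewrite px py subrr.
exists x, y, (- x - y); rewrite -/s; clearbody s; split; split; try lra.
transitivity (x ^+ 3 - (x ^+ 2 + x * y + y ^+ 2) * x); first by ring.
by rewrite xy; lra.
Qed.

(** The inequality 7/20 * de < z places the fourth center between the second and
    the third vertex along a tangent: there z > sqrt m / 2, while de^2 = 1 - m
    is at most 3/25. *)
Lemma direction_roots m : 22 / 25 <= m <= 24 / 25 ->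
  exists x y z de, [/\ x < y, y < 0, 0 < de & 7 / 20 * de < z] /\
    [/\ x + y + z = 0, 2 / 3 * (x ^+ 2 + y ^+ 2 + z ^+ 2) = m,
        x * y * z = foot_height m * de & de ^+ 2 = 1 - m].
Proof.
move=> /andP[ml mu]; pose de := Num.sqrt (1 - m).
have m0 : 0 < m by lra.
have de2 : de ^+ 2 = 1 - m by rewrite sqr_sqrtr //; lra.
have de0 : 0 < de by rewrite sqrtr_gt0; lra.
have [wl wu] : 17 / 100 <= foot_height m /\ foot_height m <= 26 / 100.
  by split; rewrite /foot_height; lra.
have q0 : 0 < foot_height m * de by rewrite mulr_gt0 //; lra.
have qm : 16 * (foot_height m * de) ^+ 2 < m ^+ 3.
  rewrite exprMn de2.
  have w2 : foot_height m ^+ 2 <= (26 / 100) ^+ 2 by rewrite lerXn2r ?nnegrE //; lra.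
  have w2m : foot_height m ^+ 2 * (1 - m) <= (26 / 100) ^+ 2 * (3 / 25).
    by rewrite ler_pM ?sqr_ge0 //; lra.
  have m3 : (22 / 25) ^+ 3 <= m ^+ 3 by rewrite lerXn2r ?nnegrE //; lra.
  lra.
have [x [y [z [[xy y0 zl] [e1 sq e3]]]]] := three_real_roots m0 q0 qm.
exists x, y, z, de; split; split => //.
apply: le_lt_trans zl; rewrite ler_pdivlMr //.
rewrite -(@ler_pXn2r _ 2) ?nnegrE ?sqrtr_ge0 ?mulr_ge0 ?ltW //; last by lra.
by rewrite !exprMn de2 sqr_sqrtr ?ltW //; lra.
Qed.

Lemma tangent_direction_arrangements m x y z de al be ga :
  x + y + z = 0 -> 2 / 3 * (x ^+ 2 + y ^+ 2 + z ^+ 2) = m ->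
  x * y * z = foot_height m * de -> de ^+ 2 = 1 - m ->
  m ^+ 2 / 16 + foot_height m ^+ 2 = m / 2 - 9 / 25 ->
  tangent_direction al be ga de <-> (al, be, ga) \in arrangements x y z.
Proof.
move=> e1 sq e3 de2 quad.
have mE : 1 - de ^+ 2 = m by rewrite de2; lra.
have newton r s t : r ^+ 2 + s ^+ 2 + t ^+ 2 =
  (r + s + t) ^+ 2 - 2 * (r * s + s * t + t * r) by ring.
move: sq; rewrite newton e1 expr0n => sq.
rewrite /tangent_direction mE newton; split.
  move=> [f1 fsq _ f3]; apply/arrangements_symmetric; rewrite f1 e1 f3 e3.
  by move: fsq; rewrite f1 expr0n => fsq; split => //; lra.
by move=> /arrangements_symmetric[-> -> ->]; rewrite e1 expr0n.
Qed.

(** For each of the two values of m, the six arrangements of the roots of the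
    cubic; the two families are disjoint because de determines m. *)
Lemma tangent_directions_seq : exists s : seq (R * R * R * R),
  [/\ uniq s, size s = 12%N &
   forall al be ga de,
     (al, be, ga, de) \in s <-> tangent_direction al be ga de /\ 0 < de].
Proof.
have [m1 [m2 [m1I m2I m12 quad]]] := quadratic_roots.
have [x1 [y1 [z1 [d1 [[xy1 y01 d01 dz1] [e1 sq1 p1 dm1]]]]]] := direction_roots m1I.
have [x2 [y2 [z2 [d2 [[xy2 y02 d02 dz2] [e2 sq2 p2 dm2]]]]]] := direction_roots m2I.
have quad1 := (quad m1).2 (or_introl erefl).
have quad2 := (quad m2).2 (or_intror erefl).
have uniq_arr (x y z d : R) : x < y -> y < 0 -> 0 < d -> 7 / 20 * d < z ->
    uniq [seq (v, d) | v <- arrangements x y z].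
  move=> xy y0 d0 dz; have hd : 0 < 7 / 20 * d by lra.
  rewrite map_inj_uniq => [|? ? [//]].
  by apply: arrangements_uniq; rewrite lt_eqF //; lra.
exists ([seq (v, d1) | v <- arrangements x1 y1 z1] ++
        [seq (v, d2) | v <- arrangements x2 y2 z2]).
split => //.
  rewrite cat_uniq !uniq_arr // andbT andTb; apply/hasPn => _ /mapP[t _ ->].
  apply/mapP => -[t' _ [_ dE]]; move: m12; rewrite -subr_eq0.
  by move=> /eqP; apply; move: dm2; rewrite dE dm1; lra.
move=> al be ga de; rewrite mem_cat; split.
  case/orP => /mapP[[[r s] t] ht [-> -> -> ->]]; split => //.
    exact/(tangent_direction_arrangements _ _ _ e1 sq1 p1 dm1 quad1).
  exact/(tangent_direction_arrangements _ _ _ e2 sq2 p2 dm2 quad2).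
move=> [dir de0].
have same_height d m : 0 < d -> d ^+ 2 = 1 - m -> 1 - de ^+ 2 = m -> de = d.
  move=> d0 dm mE; apply/eqP; rewrite -(@eqrXn2 _ 2) ?ltW // dm.
  by apply/eqP; lra.
have [_ _ /quad mE _] := dir; apply/orP; case: mE => mE; [left|right].
  have dE := same_height d1 m1 d01 dm1 mE; rewrite dE in dir *.
  by apply: map_f; apply/(tangent_direction_arrangements _ _ _ e1 sq1 p1 dm1 quad1).
have dE := same_height d2 m2 d02 dm2 mE; rewrite dE in dir *.
by apply: map_f; apply/(tangent_direction_arrangements _ _ _ e2 sq2 p2 dm2 quad2).
Qed.

End TangentDirections.

(** * The order of disjoint balls along a line *)

(** The geometric permutation given by a strict linear order r, as a set of two
    [Prop]-valued relations. *)
Definition order_pair (I : Type) (r : rel I) : set (I -> I -> Prop) :=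
  [set o | o = (fun i j => is_true (r i j)) \/ o = (fun i j => is_true (r j i))].

Lemma order_pair_sub (I : Type) (r s : rel I) : order_pair r = order_pair s ->
  r =2 s \/ r =2 (fun i j => s j i).
Proof.
move=> E; have : order_pair s (fun i j => is_true (r i j)) by rewrite -E; left.
by case=> e; [left|right] => i j; apply/idP/idP; have := congr1 (fun o => o i j) e => /= ->.
Qed.

Lemma eq_order_pair (I : Type) (r s : rel I) :
  r =2 s \/ r =2 (fun i j => s j i) -> order_pair r = order_pair s.
Proof.
case=> rs; apply/seteqP; split=> o [] ->; do ?[by left; do 2!apply/funext => ?; rewrite rs];
  by right; do 2!apply/funext => ?; rewrite rs.
Qed.

Section OrderAlongLine.
Variable R : realType.
Implicit Types (n : nat) (I : Type).

(** The parameter, on [line_through p u], of the orthogonal projection of c. *)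
Definition foot_param n (p u c : 'rV[R]_n) : R := dotp (c - p) u / dotp u u.

Lemma foot_param_lt n (p u c e : 'rV[R]_n) : u != 0 ->
  (foot_param p u c < foot_param p u e) = (dotp u c < dotp u e).
Proof.
move=> u0; rewrite ltr_pM2r ?invr_gt0 ?dotp_gt0 //.
by rewrite !(dotpDl _ (- p)) ltrD2r !(dotpC u).
Qed.

(** By Pythagoras, the squared distance from c to p + t u is a constant plus
    |u|^2 (t - foot)^2. *)
Lemma eball_closer n (p u c : 'rV[R]_n) r s t : u != 0 -> 0 <= r ->
  (t - foot_param p u c) ^+ 2 <= (s - foot_param p u c) ^+ 2 ->
  eball c r (p + s *: u) -> eball c r (p + t *: u).
Proof.
move=> u0 r0 st; have U0 := dotp_gt0 u0; set tau := foot_param p u c in st.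
have fE : dotp (p - c) u = - (tau * dotp u u).
  by rewrite divfK ?gt_eqF // -dotpNl opprB.
have dist2 v : dotp (p + v *: u - c) (p + v *: u - c) =
    dotp (p - c) (p - c) - tau ^+ 2 * dotp u u + (v - tau) ^+ 2 * dotp u u.
  rewrite addrAC (dotpDl (p - c)) 2!(dotpDr _ (p - c)) !dotpZl !dotpZr.
  by rewrite (dotpC u) fE; ring.
rewrite !eballE // !dist2; apply: le_trans.
by rewrite lerD2l ler_wpM2r // ltW.
Qed.

Lemma eball_foot n (p u c : 'rV[R]_n) r : u != 0 -> 0 <= r ->
  line_through p u `&` eball c r !=set0 -> eball c r (p + foot_param p u c *: u).
Proof.
move=> u0 r0 [x [[t _ <-] Bt]]; apply: eball_closer Bt => //.
by rewrite subrr expr0n sqr_ge0.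
Qed.

Section DisjointBalls.
Variables (n : nat) (I : Type) (c : I -> 'rV[R]_n) (r : I -> R).
Let B i := eball (c i) (r i).
Hypothesis r_ge0 : forall i, 0 <= r i.
Hypothesis disjB : trivIset [set: I] B.
Variables p u : 'rV[R]_n.
Hypothesis u0 : u != 0.
Hypothesis trans : forall i, line_through p u `&` B i !=set0.

Let footB i : B i (p + foot_param p u (c i) *: u) :=
  eball_foot u0 (r_ge0 i) (trans i).

Lemma foot_order_inj : injective (fun i => dotp u (c i)).
Proof.
move=> i j /= E; apply: disjB => //; exists (p + foot_param p u (c i) *: u).
split; first exact: footB.
have -> : foot_param p u (c i) = foot_param p u (c j).
  by apply: le_anti; rewrite !leNgt !foot_param_lt // E ltxx.
exact: footB.
Qed.

(** Each ball meets the line in an interval that contains the projection of its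
    center.  If the projections come in one order and two points of the balls in
    the other, the two intervals overlap. *)
Lemma meets_before_balls :
  meets_before B p u = (fun i j => is_true (dotp u (c i) < dotp u (c j))).
Proof.
apply/funext => i; apply/funext => j; apply/propext; rewrite -(foot_param_lt p) //.
split => [H|ij s t Bs Bt]; first by apply: H; apply: footB.
rewrite ltNge; apply/negP => ts.
suff [x [Bi Bj]] : B i `&` B j !=set0.
  have ijE : i = j by apply: disjB => //; exists x.
  by move: ij; rewrite ijE ltxx.
have [t_tau|tau_t] := leP t (foot_param p u (c i)).
  exists (p + foot_param p u (c i) *: u); split; first exact: footB.
  by apply: eball_closer Bt => //; nra.
by exists (p + t *: u); split => //; apply: eball_closer Bs => //; nra.
Qed.

End DisjointBalls.

Lemma induced_orders_balls n I (c : I -> 'rV[R]_n) (r : I -> R) p u :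
    (forall i, 0 <= r i) -> trivIset [set: I] (fun i => eball (c i) (r i)) ->
    u != 0 -> (forall i, line_through p u `&` eball (c i) (r i) !=set0) ->
  induced_orders (fun i => eball (c i) (r i)) (line_through p u) =
    order_pair (fun i j => dotp u (c i) < dotp u (c j)).
Proof.
move=> r_ge0 disjB u0 trans.
have flip i j v : (dotp (- v) (c i) < dotp (- v) (c j)) = (dotp v (c j) < dotp v (c i)).
  by rewrite !dotpNl ltrN2.
apply/seteqP; split => o.
  move=> [q [v [v0 E ->]]]; rewrite (meets_before_balls r_ge0 disjB) -?E //.
  have [a [b [_ -> b0]]] := line_through_dir v0 E.
  case: (ltrgtP b 0) b0 => // b0 _; [right|left]; do 2!apply/funext => ?.
    by rewrite !dotpZl ltr_nM2l.
  by rewrite !dotpZl ltr_pM2l.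
case=> ->; first by exists p, u; rewrite (meets_before_balls r_ge0 disjB).
exists p, (- u); rewrite oppr_eq0 line_through_opp.
rewrite (meets_before_balls r_ge0 disjB) ?oppr_eq0 ?line_through_opp //.
by split=> //; do 2!apply/funext => ?; rewrite flip.
Qed.

End OrderAlongLine.

(** * Orders of four indices *)

Lemma card_image_seq (T : eqType) (U : Type) (f : T -> U) (s : seq T) :
  uniq s -> {in s &, injective f} -> f @` [set` s] #= `I_(size s).
Proof.
move=> us fI; apply: (card_eq_trans (inj_card_eq _)).
  by move=> x y /set_mem xs /set_mem ys; apply: fI.
case: s us {fI} => [|x0 s] us; first by rewrite set_nil II0 card_eq0.
move: (x0 :: s) us => {}s us; rewrite card_eq_sym.
have <- : nth x0 s @` `I_(size s) = [set` s].
  apply/seteqP; split => [x [i /= i_s <-]|x /= xs]; first exact: mem_nth.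
  by exists (index x s); [exact: (etrans (index_mem x s)) | exact: nth_index].
rewrite card_eq_sym; apply: inj_card_eq => i j /set_mem /= ilt /set_mem /= jlt.
by move/eqP; rewrite nth_uniq // => /eqP.
Qed.

Lemma ord4P (P : 'I_4 -> Prop) :
  (forall i, P i) <->
  [/\ P (@Ordinal 4 0 isT), P (@Ordinal 4 1 isT), P (@Ordinal 4 2 isT) &
      P (@Ordinal 4 3 isT)].
Proof.
split => [H|[P0 P1 P2 P3] [[|[|[|[|//]]]] i4]]; first by split.
- by rewrite (bool_irrelevance i4 isT).
- by rewrite (bool_irrelevance i4 isT).
- by rewrite (bool_irrelevance i4 isT).
- by rewrite (bool_irrelevance i4 isT).
Qed.

(** The fourth index always gets rank 2, and t lists the ranks of the first three;
    for t an arrangement of 0, 1, 3, these orders represent, up to reversal, all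
    those for which the fourth index is not extreme. *)
Definition rank_of (t : nat * nat * nat) : 'I_4 -> nat :=
  tnth [tuple t.1.1; t.1.2; t.2; 2%N].

Definition order_of (t : nat * nat * nat) : set ('I_4 -> 'I_4 -> Prop) :=
  order_pair (fun i j => (rank_of t i < rank_of t j)%N).

(** Reversal moves the fourth index from rank 2 to rank 1, so distinct t give
    orders that are neither equal nor opposite.  The comparison of the finite
    tables of the orders is left to computation. *)
Lemma order_of_inj : {in arrangements 0%N 1%N 3%N &, injective order_of}.
Proof.
pose i0 := @Ordinal 4 0 isT; pose i1 := @Ordinal 4 1 isT.
pose i2 := @Ordinal 4 2 isT; pose i3 := @Ordinal 4 3 isT.
pose table (s : rel 'I_4) := [:: s i0 i1; s i0 i2; s i1 i2; s i0 i3; s i1 i3; s i2 i3].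
move=> t t' ht ht' /order_pair_sub E.
pose s t i j := (rank_of t i < rank_of t j)%N.
have {E} : (table (s t) == table (s t')) || (table (s t) == table (fun i j => s t' j i)).
  by apply/orP; case: E => E; [left|right]; apply/eqP; rewrite /table /s !E.
move: t t' ht ht'.
have : all (fun t => all (fun t' => (table (s t) == table (s t'))
   || (table (s t) == table (fun i j => s t' j i)) ==> (t == t')) (arrangements 0%N 1%N 3%N))
     (arrangements 0%N 1%N 3%N) by vm_compute.
by move=> /allP H t t' /H /allP H' /H' /implyP H'' /H'' /eqP.
Qed.


Lemma order_of_increasing (R : realType) (x y w z : R) (k : 'I_4 -> R)
    (t : nat * nat * nat) :
  x < y -> y < w -> w < z -> t \in arrangements 0%N 1%N 3%N ->
  (forall i, k i = nth 0 [:: x; y; w; z] (rank_of t i)) ->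
  order_pair (fun i j => k i < k j) = order_of t.
Proof.
move=> xy yw wz ht kE; apply: eq_order_pair; left => i j; rewrite !kE.
have rank_lt : forall i, (rank_of t i < 4)%N.
  move: ht; rewrite !inE => ht; apply/ord4P.
  by case/or4P: ht => [|||/or3P[]] /eqP ->.
by rewrite lt_sorted_ltn_nth ?inE //= xy yw wz.
Qed.

Lemma arrangement_rank (T : eqType) (f : nat -> T) (a b c : T) :
  (a, b, c) \in arrangements (f 0%N) (f 1%N) (f 3%N) ->
  exists2 t, t \in arrangements 0%N 1%N 3%N & (a, b, c) = (f t.1.1, f t.1.2, f t.2).
Proof.
rewrite !inE.
by case/or4P => [|||/or3P[]] /eqP ->;
  [exists (0, 1, 3)%N | exists (0, 3, 1)%N | exists (1, 0, 3)%N
  | exists (1, 3, 0)%N | exists (3, 0, 1)%N | exists (3, 1, 0)%N].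
Qed.

Lemma sort3 (R : realType) (a b c : R) : a != b -> a != c -> b != c ->
  exists x y z, [/\ x < y, y < z & (a, b, c) \in arrangements x y z].
Proof.
move=> /lt_total/orP[] ab /lt_total/orP[] ac /lt_total/orP[] bc.
- by exists a, b, c; rewrite !inE eqxx ?orbT.
- by exists a, c, b; rewrite !inE eqxx ?orbT.
- by have := lt_trans (lt_trans ab bc) ac; rewrite ltxx.
- by exists c, a, b; rewrite !inE eqxx ?orbT.
- by exists b, a, c; rewrite !inE eqxx ?orbT.
- by have := lt_trans (lt_trans ab ac) bc; rewrite ltxx.
- by exists b, c, a; rewrite !inE eqxx ?orbT.
- by exists c, b, a; rewrite !inE eqxx ?orbT.
Qed.

(** Let x < y < z be the first three values in increasing order.  If the fourth one
    lies in (y, z), the order is of the required form; if it lies in (x, y), the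
    reversed order is. *)
Lemma order_of_last_inside (R : realType) (k : 'I_4 -> R) : 
  let k0 := k (@Ordinal 4 0 isT) in let k1 := k (@Ordinal 4 1 isT) in
  let k2 := k (@Ordinal 4 2 isT) in let k3 := k (@Ordinal 4 3 isT) in
  injective k ->
  ~ [/\ k3 <= k0, k3 <= k1 & k3 <= k2] -> ~ [/\ k0 <= k3, k1 <= k3 & k2 <= k3] ->
  exists2 t, t \in arrangements 0%N 1%N 3%N &
    order_pair (fun i j => k i < k j) = order_of t.
Proof.
move=> k0 k1 k2 k3 kI nmin nmax.
have ne i j : i != j -> k i != k j by apply: contraNneq => /kI ->.
have [x [y [z [xy yz abc]]]] : exists x y z,
    [/\ x < y, y < z & (k0, k1, k2) \in arrangements x y z].
  by apply: sort3; apply: ne.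
have [nx ny nz] : [/\ k3 != x, k3 != y & k3 != z].
  move: abc; rewrite !inE !xpair_eqE.
  by case/or4P => [|||/or3P[]] /andP[/andP[]] /eqP<- /eqP<- /eqP<-; split; apply: ne.
have xk : x < k3.
  rewrite ltNge; apply/negP => kx; apply: nmin.
  have ky := le_trans kx (ltW xy); have kz := le_trans ky (ltW yz).
  by move: abc; rewrite !inE !xpair_eqE;
    case/or4P => [|||/or3P[]] /andP[/andP[]] /eqP-> /eqP-> /eqP->.
have kz : k3 < z.
  rewrite ltNge; apply/negP => kz; apply: nmax.
  have ky := le_trans (ltW yz) kz; have kx := le_trans (ltW xy) ky.
  by move: abc; rewrite !inE !xpair_eqE;
    case/or4P => [|||/or3P[]] /andP[/andP[]] /eqP-> /eqP-> /eqP->.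
have [ky|yk] := ltP k3 y.
  pose f := nth 0 [:: - z; - y; - k3; - x].
  have /(arrangement_rank (f := f))[t ht [e0 e1 e2]] :
      (- k0, - k1, - k2) \in arrangements (- z) (- y) (- x).
    by move: abc; rewrite !inE !xpair_eqE !eqr_opp;
      case/or4P => [|||/or3P[]] ->; rewrite ?orbT.
  exists t => //; rewrite -(@order_of_increasing R (- z) (- y) (- k3) (- x) (fun i => - k i));
    rewrite ?ltrN2 //.
    by apply: eq_order_pair; right => i j; rewrite ltrN2.
  exact/ord4P.
have {}yk : y < k3 by rewrite lt_neqAle eq_sym ny.
have [t ht [e0 e1 e2]] := arrangement_rank (f := nth 0 [:: x; y; k3; z]) abc.
exists t => //; apply: (order_of_increasing xy yk kz ht); exact/ord4P.
Qed.

(** * A frame attached to the triangle *)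

Record triangle_frame (R : realType) (A B C N : 'rV[R]_3) : Prop := {
  frame_sum : A + B + C = 0;
  frame_AA : dotp A A = 1;
  frame_BB : dotp B B = 1;
  frame_AB : dotp A B = - (1 / 2);
  frame_NA : dotp N A = 0;
  frame_NB : dotp N B = 0;
  frame_NN : dotp N N = 1 }.

Lemma edist_axis (R : realType) (a b c d : 'rV[R]_3) : triangle_axis a b c d ->
  dist_to_set d (triangle_plane a b c) = edist d (centroid a b c).
Proof.
move=> axis; set o := centroid a b c.
have plane_o : triangle_plane a b c o.
  by exists 3^-1, 3^-1; rewrite /o /centroid; apply/rowP => i; rewrite !mxE; field.
have nearest y : triangle_plane a b c y -> edist d o <= edist d y.
  move=> plane_y; rewrite ler_sqrt ?dotp_ge0 //.
  have -> : d - y = (d - o) + (o - y) by rewrite addrA subrK.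
  rewrite (dotpDl (d - o)) 2!(dotpDr _ (d - o)) (dotpC (o - y)) (axis o y) //.
  rewrite addr0 add0r.
  by rewrite lerDl dotp_ge0.
have lb : lbound [set edist d y | y in triangle_plane a b c] (edist d o).
  by move=> r [v plane_v <-]; apply: nearest.
apply/le_anti/andP; split; last first.
  by apply: lb_le_inf => //; exists (edist d o), o.
by apply: ge_inf; [exists (edist d o) | exists o].
Qed.

(** The three side lengths are linear equations in |A|^2, |B|^2 and the product of
    A and B, once C is replaced by - A - B; and d is at distance h from o, the
    point of the plane nearest to d. *)
Lemma frame_of_triangle (R : realType) (a b c d : 'rV[R]_3) (h : R) : 0 < h ->
  equilateral (Num.sqrt 3) a b c -> triangle_axis a b c d ->
  dist_to_set d (triangle_plane a b c) = h ->
  exists o A B C N, triangle_frame A B C N /\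
    [/\ a = o + A, b = o + B, c = o + C & d = o + h *: N].
Proof.
move=> h0 [ab bc ca] axis; rewrite edist_axis //; set o := centroid a b c => dh.
pose A := a - o; pose B := b - o; pose C := c - o.
exists o, A, B, C, (h^-1 *: (d - o)).
have sum0 : A + B + C = 0.
  by rewrite /A /B /C /o /centroid; apply/rowP => i; rewrite !mxE; field.
have CE : C = - A - B.
  by apply: (addrI (A + B)); rewrite sum0 -opprD subrr.
have sq3 : Num.sqrt (3 : R) ^+ 2 = 3 by rewrite sqr_sqrtr.
have diff (x y : 'rV[R]_3) : x - y = (x - o) - (y - o) by rewrite opprB addrA subrK.
have := edist_sqr a b; have := edist_sqr b c; have := edist_sqr c a.
rewrite ab bc ca sq3 (diff a b) (diff b c) (diff c a) -/A -/B -/C CE.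
have plane_o : triangle_plane a b c o.
  by exists 3^-1, 3^-1; rewrite /o /centroid; apply/rowP => i; rewrite !mxE; field.
have plane_a : triangle_plane a b c a by exists 0, 0; rewrite !scale0r !addr0.
have plane_b : triangle_plane a b c b.
  by exists 1, 0; rewrite scale0r scale1r addr0 subrKC.
have NA := axis _ _ plane_a plane_o; have NB := axis _ _ plane_b plane_o.
have NN : dotp (d - o) (d - o) = h ^+ 2 by rewrite -edist_sqr dh.
move: (d - o) NA NB NN (subrKC o d) sum0 => D; rewrite -/o -/A -/B.
move: (subrKC o a) (subrKC o b) (subrKC o c); rewrite -/A -/B -/C CE.
move: A B {C CE} => A B aE bE cE NA NB NN dE sum0.
rewrite !dotpE (dotpC B A) => e1 e2 e3; split; last first.
  by rewrite scalerA divff ?gt_eqF // scale1r.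
split => //; try lra.
- by rewrite dotpZl NA mulr0.
- by rewrite dotpZl NB mulr0.
- by rewrite dotpZl dotpZr NN; field; rewrite gt_eqF.
Qed.

Section Frame.
Variables (R : realType) (A B C N : 'rV[R]_3).
Hypothesis frame : triangle_frame A B C N.
Implicit Types u v q : 'rV[R]_3.

Let CE : C = - A - B.
Proof. by apply: (addrI (A + B)); rewrite (frame_sum frame) -opprD subrr. Qed.

Lemma frame_CC : dotp C C = 1.
Proof.
rewrite CE !dotpE (dotpC B A) (frame_AA frame) (frame_BB frame) (frame_AB frame).
lra.
Qed.

Lemma frame_dotp_sum u : dotp u A + dotp u B + dotp u C = 0.
Proof. by rewrite -!dotpDr (frame_sum frame) dotp0r. Qed.

(** A, A + 2B and N are orthogonal and nonzero, so the matrix with these rows is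
    invertible. *)
Lemma frame_eq0 u : dotp u A = 0 -> dotp u B = 0 -> dotp u N = 0 -> u = 0.
Proof.
move=> uA uB uN.
pose e := tnth [tuple A; A + 2 *: B; N].
pose F : 'M[R]_3 := \matrix_i e i.
have FF : F *m F^T = diag_mx (\row_i dotp (e i) (e i)).
  apply/matrixP => i j; rewrite mxE.
  transitivity (dotp (e i) (e j)).
    by apply: eq_bigr => k _; rewrite !mxE.
  rewrite !mxE; case: eqVneq => [->|ij]; first by rewrite mulr1n.
  rewrite mulr0n; move: ij.
  have AeB : dotp A (A + 2 *: B) = 0.
    by rewrite !dotpE (frame_AA frame) (frame_AB frame); lra.
  have NeB : dotp N (A + 2 *: B) = 0.
    by rewrite !dotpE (frame_NA frame) (frame_NB frame); lra.
  have NA := frame_NA frame.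
  by case: i => [[|[|[|//]]] ?]; case: j => [[|[|[|//]]] ?] //= _;
    rewrite /e /tnth /= // dotpC.
have F_unit : F^T \in unitmx.
  have : F *m F^T \in unitmx.
    rewrite FF unitmxE det_diag unitfE !big_ord_recl big_ord0 !mxE /e /tnth /=.
    rewrite !dotpE (dotpC B A) (frame_AA frame) (frame_BB frame) (frame_AB frame).
    by rewrite (frame_NN frame); apply/eqP; lra.
  by rewrite unitmx_mul => /andP[].
have uF : u *m F^T = 0.
  apply/rowP => i; rewrite [RHS]mxE; transitivity (dotp u (e i)).
    by rewrite mxE; apply: eq_bigr => k _; rewrite !mxE.
  case: i => [[|[|[|//]]] ?]; rewrite /e /tnth //=.
  by rewrite dotpDr dotpZr uA uB mulr0 addr0.
by rewrite -(mulmxK F_unit u) uF mul0mx.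
Qed.

(** The vector with products x, y, z, w with A, B, C, N, when x + y + z = 0.  The
    factor 2/3 comes from the redundancy of A, B, C, whose rank-one projections
    add up to 3/2 times the projection onto their plane. *)
Definition spatial (x y z w : R) : 'rV[R]_3 :=
  (2 / 3) *: (x *: A + y *: B + z *: C) + w *: N.

Lemma dotp_spatialA x y z w : x + y + z = 0 -> dotp (spatial x y z w) A = x.
Proof.
move=> e1; rewrite /spatial CE !dotpE (dotpC B A) (frame_AA frame).
by rewrite (frame_AB frame) (frame_NA frame); lra.
Qed.

Lemma dotp_spatialB x y z w : x + y + z = 0 -> dotp (spatial x y z w) B = y.
Proof.
move=> e1; rewrite /spatial CE !dotpE (frame_BB frame).
by rewrite (frame_AB frame) (frame_NB frame); lra.
Qed.

Lemma dotp_spatialN x y z w : dotp (spatial x y z w) N = w.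
Proof.
rewrite /spatial CE !dotpE !(dotpC _ N) (frame_NA frame) (frame_NB frame).
by rewrite (frame_NN frame); lra.
Qed.

Lemma dotp_spatialC x y z w : x + y + z = 0 -> dotp (spatial x y z w) C = z.
Proof.
move=> e1; have := frame_dotp_sum (spatial x y z w).
by rewrite dotp_spatialA // dotp_spatialB //; lra.
Qed.

Lemma spatialE u : u = spatial (dotp u A) (dotp u B) (dotp u C) (dotp u N).
Proof.
have e1 := frame_dotp_sum u.
apply/subr0_eq/frame_eq0; rewrite dotpDl dotpNl.
- by rewrite dotp_spatialA // subrr.
- by rewrite dotp_spatialB // subrr.
- by rewrite dotp_spatialN subrr.
Qed.

Lemma dotp_frame u v :
  dotp u v = 2 / 3 * (dotp u A * dotp v A + dotp u B * dotp v B + dotp u C * dotp v C)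
             + dotp u N * dotp v N.
Proof.
by rewrite {1}(spatialE u) /spatial !(dotpDl, dotpZl) !(dotpC _ v).
Qed.

End Frame.

(** * The four spheres *)

Section Configuration.
Variables (R : realType) (o A B C N : 'rV[R]_3).
Hypothesis frame : triangle_frame A B C N.
Implicit Types (al be ga de x y z w : R) (u q : 'rV[R]_3).

Let h : R := 7 / 20.
Let center := tnth [tuple o + A; o + B; o + C; o + h *: N].
Let radius := tnth [tuple 4 / 5; 4 / 5; 4 / 5; 1 / 4 : R].
Let ball (i : 'I_4) := eball (center i) (radius i).
Let sphere (i : 'I_4) := esphere (center i) (radius i).

Lemma radius_gt0 i : 0 < radius i.
Proof. by move: i; apply/ord4P; split; rewrite /radius /tnth /= ?divr_gt0. Qed.

Lemma centers_far i j : i != j ->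
  (radius i + radius j) ^+ 2 < dotp (center i - center j) (center i - center j).
Proof.
have diff (x y : 'rV[R]_3) : o + x - (o + y) = x - y by rewrite opprD addrACA subrr add0r.
have AC : dotp A C = - (1 / 2).
  by have := frame_dotp_sum frame A; rewrite (frame_AA frame) (frame_AB frame); lra.
have BC : dotp B C = - (1 / 2).
  have := frame_dotp_sum frame B.
  by rewrite (dotpC B A) (frame_BB frame) (frame_AB frame); lra.
have NC : dotp N C = 0.
  have := frame_dotp_sum frame N.
  by rewrite (frame_NA frame) (frame_NB frame); lra.
move: i j; apply/ord4P; split; apply/ord4P; split;
  rewrite // /radius /center /tnth /= diff !dotpE;
  rewrite ?(dotpC B A) ?(dotpC C A) ?(dotpC C B) ?(dotpC _ N);
  rewrite ?(frame_AA frame) ?(frame_BB frame) ?(frame_CC frame) ?(frame_NN frame);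
  rewrite ?(frame_AB frame) ?AC ?BC ?(frame_NA frame) ?(frame_NB frame) ?NC /h;
  lra.
Qed.

Lemma balls_disjoint : trivIset [set: 'I_4] ball.
Proof.
move=> i j _ _ [x [xi xj]]; apply/eqP; apply: contraT => ij.
by case: (eball_disjoint (radius_gt0 i) (radius_gt0 j) (centers_far ij) xi xj).
Qed.

Lemma spheres_disjoint : trivIset [set: 'I_4] sphere.
Proof.
move=> i j _ _ [x [xi xj]]; apply: balls_disjoint => //; exists x.
by rewrite /ball /eball /= xi xj.
Qed.

Section NormalLine.
Variables q u : 'rV[R]_3.
Hypothesis uu : dotp u u = 1.
Hypothesis qu : dotp q u = 0.

Lemma dist2_vertices :
  [/\ line_dist2 (o + q) u (o + A) = dotp q q - 2 * dotp q A + 1 - dotp u A ^+ 2,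
      line_dist2 (o + q) u (o + B) = dotp q q - 2 * dotp q B + 1 - dotp u B ^+ 2,
      line_dist2 (o + q) u (o + C) = dotp q q - 2 * dotp q C + 1 - dotp u C ^+ 2 &
      line_dist2 (o + q) u (o + h *: N) =
        dotp q q - 2 * (h * dotp q N) + h ^+ 2 - (h * dotp u N) ^+ 2].
Proof.
rewrite !line_dist2_foot // (frame_AA frame) (frame_BB frame) (frame_CC frame).
by split => //; rewrite !dotpZr dotpZl (frame_NN frame); ring.
Qed.

Lemma unit_coordinates :
  2 / 3 * (dotp u A ^+ 2 + dotp u B ^+ 2 + dotp u C ^+ 2) + dotp u N ^+ 2 = 1.
Proof. by have := dotp_frame frame u u; rewrite uu !expr2 => /esym. Qed.

Lemma tangent_lineP4 :
  (forall i, tangent (line_through (o + q) u) (sphere i)) <->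
  tangent_direction (dotp u A) (dotp u B) (dotp u C) (dotp u N) /\
  let m := 1 - dotp u N ^+ 2 in
  [/\ dotp q A = m / 4 - dotp u A ^+ 2 / 2,
      dotp q B = m / 4 - dotp u B ^+ 2 / 2,
      dotp q C = m / 4 - dotp u C ^+ 2 / 2 & dotp q N = foot_height m].
Proof.
have [dA dB dC dN] := dist2_vertices.
have e1 := frame_dotp_sum frame u.
have := tangency_system (dotp q A) (dotp q B) (dotp q C) (dotp q N) e1 unit_coordinates.
rewrite /= => <-.
have -> : 2 / 3 * (dotp q A ^+ 2 + dotp q B ^+ 2 + dotp q C ^+ 2) + dotp q N ^+ 2
    = dotp q q by rewrite [RHS](dotp_frame frame) !expr2.
have tangentP i := tangent_lineP (o + q) (center i) uu (ltW (radius_gt0 i)).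
split=> [H|[_ _ H] i].
  have /ord4P : forall i, line_dist2 (o + q) u (center i) = radius i ^+ 2.
    by move=> i; apply/tangentP; exact: H.
  rewrite /center /radius /tnth /= dA dB dC dN => H'.
  split; last exact: H'.
    exact: (frame_dotp_sum frame).
  by rewrite -(dotp_frame frame).
apply/tangentP; move: i; apply/ord4P.
by rewrite /center /radius /tnth /= dA dB dC dN.
Qed.

(** The sum of the three conditions at the vertices gives 1 - de^2 >= 18/25.  If
    h * de were extreme, [sum_sqr_bounded_below] would give
    1 - de^2 <= 4 h^2 de^2, which is much smaller. *)
Lemma last_not_extreme : (forall i, line_through (o + q) u `&` ball i !=set0) ->
  let k i := dotp u (center i) in
  let k0 := k (@Ordinal 4 0 isT) in let k1 := k (@Ordinal 4 1 isT) in
  let k2 := k (@Ordinal 4 2 isT) in let k3 := k (@Ordinal 4 3 isT) in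
  ~ [/\ k3 <= k0, k3 <= k1 & k3 <= k2] /\ ~ [/\ k0 <= k3, k1 <= k3 & k2 <= k3].
Proof.
have [dA dB dC _] := dist2_vertices.
have meetsP i := meets_ballP (o + q) (center i) uu (ltW (radius_gt0 i)).
move=> H; have /ord4P : forall i, line_dist2 (o + q) u (center i) <= radius i ^+ 2.
  by move=> i; apply/meetsP; exact: H.
rewrite /center /radius /tnth /= dA dB dC => -[tA tB tC _].
rewrite !dotpDr dotpZr !lerD2l.
have := unit_coordinates; have := dotp_ge0 q; have := frame_dotp_sum frame q.
have := frame_dotp_sum frame u.
move: (dotp u A) (dotp u B) (dotp u C) (dotp u N) (dotp q q) tA tB tC.
move: (dotp q A) (dotp q B) (dotp q C) => x y z al be ga de P tA tB tC e1 e2 P0 m1.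
have de2 : de ^+ 2 <= 7 / 25 by lra.
split=> -[l0 l1 l2].
  have := sum_sqr_bounded_below e1 l0 l1 l2; rewrite exprMn /h; lra.
have e1' : - al + - be + - ga = 0 by lra.
move: l0 l1 l2; rewrite -lerN2 -[be <= _]lerN2 -[ga <= _]lerN2 => l0 l1 l2.
have := sum_sqr_bounded_below e1' l0 l1 l2.
rewrite !sqrrN exprMn /h; lra.
Qed.

End NormalLine.

(** The foot o + q of the line is the one forced by [tangency_system]. *)
Definition direction_line (s : R * R * R * R) : set 'rV[R]_3 :=
  let: (al, be, ga, de) := s in let m := 1 - de ^+ 2 in
  line_through
    (o + spatial A B C N (m / 4 - al ^+ 2 / 2) (m / 4 - be ^+ 2 / 2)
                         (m / 4 - ga ^+ 2 / 2) (foot_height m))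
    (spatial A B C N al be ga de).

Lemma direction_line_normal al be ga de : tangent_direction al be ga de ->
  exists q u, [/\ dotp u u = 1, dotp q u = 0,
    direction_line (al, be, ga, de) = line_through (o + q) u &
    [/\ dotp u A = al, dotp u B = be, dotp u C = ga & dotp u N = de] /\
    forall i, tangent (line_through (o + q) u) (sphere i)].
Proof.
move=> dir; have [e1 sq _ _] := dir; pose m : R := 1 - de ^+ 2.
pose x := m / 4 - al ^+ 2 / 2; pose y := m / 4 - be ^+ 2 / 2.
pose z := m / 4 - ga ^+ 2 / 2; pose w := foot_height m.
have u1 : 2 / 3 * (al ^+ 2 + be ^+ 2 + ga ^+ 2) + de ^+ 2 = 1 by rewrite sq; lra.
have [_ sys] := tangency_system x y z w e1 u1.
have [f1 f2 _] := sys (conj dir (And4 erefl erefl erefl erefl)).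
exists (spatial A B C N x y z w), (spatial A B C N al be ga de).
set q := spatial _ _ _ _ x y z w; set u := spatial _ _ _ _ al be ga de.
have uA : dotp u A = al := dotp_spatialA frame de e1.
have uB : dotp u B = be := dotp_spatialB frame de e1.
have uC : dotp u C = ga := dotp_spatialC frame de e1.
have uN : dotp u N = de := dotp_spatialN frame al be ga de.
have qA : dotp q A = x := dotp_spatialA frame w f1.
have qB : dotp q B = y := dotp_spatialB frame w f1.
have qC : dotp q C = z := dotp_spatialC frame w f1.
have qN : dotp q N = w := dotp_spatialN frame x y z w.
have uu : dotp u u = 1 by rewrite (dotp_frame frame) uA uB uC uN -!expr2.
have qu : dotp q u = 0 by rewrite (dotp_frame frame) uA uB uC uN qA qB qC qN.
split => //; split => //.
by apply/tangent_lineP4 => //; rewrite uA uB uC uN qA qB qC qN.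
Qed.

(** Reversing u allows de >= 0, and de = 0 is excluded because m = 1 is not a root of
    the quadratic equation. *)
Lemma common_tangentsE (L : set 'rV[R]_3) : common_tangents sphere L <->
  exists al be ga de,
    [/\ tangent_direction al be ga de, 0 < de & L = direction_line (al, be, ga, de)].
Proof.
split; last first.
  move=> [al [be [ga [de [dir de0 ->]]]]].
  have [q [u [uu qu -> [_ tan]]]] := direction_line_normal dir.
  by split => //; exists (o + q), u; split => //; rewrite -dotp_eq0 uu oner_eq0.
move=> [/(line_through_normal o)[q [v [vv qv ->]]] tan].
have [u [uu qu uN uL]] : exists u, [/\ dotp u u = 1, dotp q u = 0, 0 <= dotp u N &
    line_through (o + q) v = line_through (o + q) u].
  have [vN|vN] := leP 0 (dotp v N); first by exists v.
  exists (- v); rewrite line_through_opp !dotpNl !dotpNr vv qv opprK oppr0.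
  by split => //; rewrite oppr_ge0 ltW.
move: tan; rewrite uL => /(tangent_lineP4 uu qu)[dir [qA qB qC qN]].
exists (dotp u A), (dotp u B), (dotp u C), (dotp u N); split => //.
  rewrite lt_neqAle uN andbT; apply/eqP => uN0.
  by case: dir => _ _ + _; rewrite -uN0 expr0n subr0 /foot_height; lra.
by rewrite /direction_line -qA -qB -qC -qN -!(spatialE frame).
Qed.

Lemma direction_line_inj al be ga de al' be' ga' de' :
  tangent_direction al be ga de -> tangent_direction al' be' ga' de' ->
  0 < de -> 0 < de' ->
  direction_line (al, be, ga, de) = direction_line (al', be', ga', de') ->
  (al, be, ga, de) = (al', be', ga', de').
Proof.
move=> /direction_line_normal[q [u [uu qu -> [[<- <- <- <-] _]]]].
move=> /direction_line_normal[q' [u' [uu' qu' -> [[<- <- <- <-] _]]]] uN uN'.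
move=> /(line_through_normal_inj uu uu' qu qu')[_ [-> //|uE]].
by move: uN'; rewrite uE dotpNl oppr_gt0 ltNge (ltW uN).
Qed.

Lemma card_common_tangents : common_tangents sphere #= `I_12.
Proof.
have [s [us <- sP]] := tangent_directions_seq R.
have -> : common_tangents sphere = direction_line @` [set` s].
  apply/seteqP; split => L.
    move=> /common_tangentsE[al [be [ga [de [dir de0 ->]]]]].
    by exists (al, be, ga, de) => //; apply/sP.
  move=> [[[[al be] ga] de] /sP[dir de0] <-].
  by apply/common_tangentsE; exists al, be, ga, de.
apply: card_image_seq us _ => -[[[al be] ga] de] [[[al' be'] ga'] de'].
by move=> /sP[dir de0] /sP[dir' de0']; apply: direction_line_inj.
Qed.

Lemma induced_orders_normal q u : dotp u u = 1 ->
  (forall i, line_through (o + q) u `&` ball i !=set0) ->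
  induced_orders ball (line_through (o + q) u) =
    order_pair (fun i j => dotp u (center i) < dotp u (center j)).
Proof.
move=> uu; apply: induced_orders_balls.
- by move=> i; apply/ltW/radius_gt0.
- exact: balls_disjoint.
- by rewrite -dotp_eq0 uu oner_eq0.
Qed.

(** The six permutations are realized by common tangents: an arrangement t of the
    ranks 0, 1, 3 is the order of the centers along the tangent for which al, be,
    ga is the same arrangement of the roots x < y < z. *)
Lemma geometric_permutationsE :
  geometric_permutations ball = order_of @` [set` arrangements 0%N 1%N 3%N].
Proof.
apply/seteqP; split => g.
  move=> [L [/(line_through_normal o)[q [u [uu qu ->]]] meets] <-].
  have u0 : u != 0 by rewrite -dotp_eq0 uu oner_eq0.
  have [nmin nmax] := last_not_extreme uu qu meets.
  have r0 i := ltW (radius_gt0 i).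
  have kI := foot_order_inj r0 balls_disjoint u0 meets.
  have [t ht tE] := order_of_last_inside kI nmin nmax.
  by exists t => //; rewrite induced_orders_normal.
move=> [t /= ht <-].
have [m [m2 [mI _ _ quad]]] := quadratic_roots R.
have [x [y [z [de [[xy y0 de0 dez] [e1 sq e3 de2]]]]]] := direction_roots mI.
pose f := nth 0 [:: x; y; h * de; z].
have arr : (f t.1.1, f t.1.2, f t.2) \in arrangements x y z.
  by case: t ht => -[r1 r2] r3; apply: (arrangements_map f).
have quad_m : m ^+ 2 / 16 + foot_height m ^+ 2 = m / 2 - 9 / 25 by apply/quad; left.
have dir := (tangent_direction_arrangements _ _ _ e1 sq e3 de2 quad_m).2 arr.
have [q [u [uu qu LE [[uA uB uC uN] tan]]]] := direction_line_normal dir.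
have meets i : line_through (o + q) u `&` ball i !=set0.
  by have [p [[Lp Sp] _]] := tan i; exists p; split => //; rewrite /ball /eball /= Sp.
exists (line_through (o + q) u).
  by split => //; exists (o + q), u; split => //; rewrite -dotp_eq0 uu oner_eq0.
rewrite induced_orders_normal //; set e := dotp u o.
apply: (@order_of_increasing R (e + x) (e + y) (e + h * de) (e + z)) => //.
- by rewrite ltrD2l.
- by rewrite ltrD2l (lt_trans y0) // mulr_gt0 // /h divr_gt0.
- by rewrite ltrD2l.
have shift n : (n < 4)%N -> nth 0 [:: e + x; e + y; e + h * de; e + z] n = e + f n.
  by case: n => [|[|[|[|]]]].
have rank_lt : [/\ (t.1.1 < 4)%N, (t.1.2 < 4)%N & (t.2 < 4)%N].
  by move: ht; rewrite !inE => /or4P[|||/or3P[]] /eqP ->.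
case: rank_lt => l0 l1 l2; apply/ord4P; rewrite /rank_of /center /tnth /=.
by rewrite !shift // !dotpDr dotpZr uA uB uC uN.
Qed.

Lemma card_geometric_permutations : geometric_permutations ball #= `I_6.
Proof.
rewrite geometric_permutationsE.
by apply: (card_image_seq (s := arrangements 0%N 1%N 3%N)) order_of_inj.
Qed.

End Configuration.

Theorem mainTheorem1 (R : realType) (a b c d : 'rV[R]_3)
    (habc : equilateral (Num.sqrt 3) a b c)
    (hd_axis : triangle_axis a b c d)
    (hd_dist : dist_to_set d (triangle_plane a b c) = 35 / 100) :
  let center := tnth [tuple a; b; c; d] in
  let radius := tnth [tuple 4 / 5; 4 / 5; 4 / 5; 1 / 4 : R] in
  let S := fun i : 'I_4 => esphere (center i) (radius i) in
  let B := fun i : 'I_4 => eball (center i) (radius i) in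
  [/\ trivIset [set: 'I_4] S,
      common_tangents S #= `I_12,
      trivIset [set: 'I_4] B &
      geometric_permutations B #= `I_6].
Proof.
have hE : 35 / 100 = 7 / 20 :> R by lra.
have h0 : 0 < 7 / 20 :> R by lra.
rewrite hE in hd_dist.
have [o [A [B' [C [N [frame [-> -> -> ->]]]]]]] :=
  frame_of_triangle h0 habc hd_axis hd_dist.
move=> center radius S B; split.
- exact: spheres_disjoint.
- exact: card_common_tangents.
- exact: balls_disjoint.
- exact: card_geometric_permutations.
Qed.
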